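(* Let $n>1$ be an integer, let $p$ be the least prime divisor of $n$, and let $q$ be a prime power. Then $$\mathcal{C}(\mathbb{F}_{q^n}/\mathbb{F}_q)=n-\frac np.$$
   Context: Let $K\subseteq L$ be a finite field extension with $[L:K]>1$. A nonzero $K$-subspace $A\subseteq L$ is called a Chowla subspace if $[K(a):K]>\dim_K A$ for every $0\ne a\in A$. Define $\mathcal{C}(L/K)=\max\{\dim_K A:A\subseteq L\text{ is a Chowla }K\text{-subspace}\}$. $\mathbb{F}_q$ denotes the finite field with $q$ elements, and $\mathbb{F}_{q^n}$ its extension of degree $n$. *)

(* Defs.v *)
From HB Require Import structures.
From mathcomp Require Import all_boot all_order all_algebra all_field.
From mathcomp Require Import boolp.

Set Implicit Arguments.
Unset Strict Implicit.
Unset Printing Implicit Defensive.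

Import GRing.Theory.
Local Open Scope ring_scope.

(* [\dim] is the dimension over K, so [\dim <<1; a>>] is the degree [K(a) : K]. *)
Definition chowla (K : fieldType) (L : fieldExtType K) (A : {vspace L}) : Prop :=
  A <> 0%VS /\
  forall a : L, a \in A -> a != 0 -> (\dim A < \dim <<1%VS; a>>%VS)%N.

(* The maximum of an empty family is 0 by convention; [chowla_numP] shows that
   the family is nonempty, and the maximum attained, whenever [L : K] > 1. *)
Definition chowla_num (K : fieldType) (L : fieldExtType K) : nat :=
  \max_(d < (\dim {:L}).+1 | `[< exists A : {vspace L}, chowla A /\ \dim A = d >]) d.

Lemma chowla_num_ge (K : fieldType) (L : fieldExtType K) (A : {vspace L}) :
  chowla A -> (\dim A <= chowla_num L)%N.
Proof.
move=> hA; have dA : (\dim A < (\dim {:L}).+1)%N by rewrite ltnS dimvS ?subvf.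
rewrite /chowla_num.
apply: (@leq_bigmax_cond _ _ (fun d : 'I__ => nat_of_ord d) (Ordinal dA)).
by apply/asboolP; exists A.
Qed.

Lemma chowla_exists (K : fieldType) (L : fieldExtType K) :
  (1 < \dim {:L})%N -> exists A : {vspace L}, chowla A.
Proof.
move=> hL.
have [a aN1] : exists a : L, a \notin 1%VS.
  apply: contrapT => h; have s1 : ({:L} <= 1)%VS.
    by apply/subvP => a _; apply: contrapT => /negP ha; apply: h; exists a.
  by move: (dimvS s1); rewrite dimv1 leqNgt hL.
have a0 : a != 0 by apply: contraNneq aN1 => ->; rewrite mem0v.
exists <[a]>%VS; split; first by move/eqP; rewrite -dimv_eq0 dim_vline a0.
move=> b /vlineP[k ->] kb0; rewrite dim_vline a0 /=.
rewrite ltn_neqAle adim_gt0 andbT eq_sym.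
apply: contra aN1 => /eqP d1.
have k0 : k != 0 by apply: contraNneq kb0 => ->; rewrite scale0r.
have : (1 == <<1; k *: a>>)%VS by rewrite eqEdim sub1v dimv1 d1.
move/eqP => e; have := memv_adjoin 1%AS (k *: a); rewrite -e => h.
by rewrite -[a]scale1r -(mulVf k0) -scalerA memvZ.
Qed.

Lemma chowla_numP (K : fieldType) (L : fieldExtType K) :
  (1 < \dim {:L})%N -> exists2 A : {vspace L}, chowla A & \dim A = chowla_num L.
Proof.
move=> /chowla_exists[A hA].
have dA : (\dim A < (\dim {:L}).+1)%N by rewrite ltnS dimvS ?subvf.
have hP : `[< exists B : {vspace L}, chowla B /\ \dim B = Ordinal dA >].
  by apply/asboolP; exists A.
rewrite /chowla_num (bigmax_eq_arg _ hP).
by case: arg_maxnP => // i /asboolP[B [hB dB]] _; exists B.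
Qed.

(* Main.v *)
Require Import Defs.
From mathcomp Require Import all_boot all_order all_algebra all_field.
From mathcomp Require Import fingroup cyclic zify.

(** Write [q] for the order of the base field [F], [n] for the degree of [L]
    over [F], [p] for the least prime divisor of [n], [m = n / p], and [M] for
    the subfield of [L] of dimension [m], the largest proper one.

    Upper bound ([dim_chowla_le]).  A subspace of dimension larger than
    [n - m] meets [M] in a nonzero element, whose degree is at most
    [m <= n - m]; so it is not a Chowla subspace.

    Lower bound ([exists_chowla]).  A proper divisor of [n] is at most [m], so
    a subspace [A] of dimension [n - m] is Chowla as soon as each of its
    nonzero elements has degree greater than [m], since that degree is then
    [n].  Take a hyperplane [H] of [L] over [M], and look for [A] among the
    multiples [c^-1 * H], [c != 0].  A given nonzero [x] lies in [c^-1 * H]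
    exactly when [c * x] is in [H], hence for [q ^ (n - m) - 1] values of [c].
    All the elements of degree [m] lie in [M], and since [c^-1 * H] is stable
    under [M], it avoids all of them once it avoids [1].  The elements left to
    avoid have degree less than [m], and a degree determines the subfield, so
    there are at most [\sum_(0 <= d < m) (q ^ d - 1) < q ^ m] of them.
    With [1], at most [q ^ m] elements [x] are to be avoided, which excludes
    at most [q ^ m * (q ^ (n - m) - 1) = q ^ n - q ^ m] values of [c],
    fewer than the [q ^ n - 1] available ones.  This holds for every [q]:
    treating [M] as one element makes the count succeed even for [q = 2]. *)

Set Implicit Arguments.
Unset Strict Implicit.
Unset Printing Implicit Defensive.

Import GRing.Theory.
Local Open Scope ring_scope.

(** As a vector space over [M], [L] is a direct sum of lines [M * <[x]>];
    all of them but one span the hyperplane. *)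
Lemma subfield_hyperplane (K : fieldType) (L : fieldExtType K)
    (M : {subfield L}) :
  exists2 H : {vspace L}, (M * H <= H)%VS & \dim H = (\dim {:L} - \dim M)%N.
Proof.
have [X []] := skew_field_module_semisimple (@fieldP L) (subvf (M * {:L})).
move=> defL /directvP/=; rewrite defL => dimL nzX.
case: X => [|x X] in defL dimL nzX *.
  move: (oner_neq0 L); rewrite -memv0.
  by move: defL; rewrite big_nil => ->; rewrite memvf.
rewrite !big_cons in defL dimL.
exists (\sum_(y <- X) M * <[y]>)%VS.
  elim: X {defL dimL nzX} => [|y X IH]; first by rewrite big_nil prodv0 sub0v.
  by rewrite big_cons prodvDr addvS // prodvA prodv_id.
have nzx : x != 0 by move: nzX; rewrite inE negb_or eq_sym => /andP[].
rewrite dim_cosetv // in dimL.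
have leH := dimv_leq_sum X xpredT (fun y : L => (M * <[y]>)%VS).
have := dimv_add_leqif (M * <[x]>) (\sum_(y <- X) M * <[y]>)%VS.
rewrite defL dim_cosetv //; case=> leL _.
move: leL; rewrite dimL leq_add2l addKn => leL.
by apply/eqP; rewrite eqn_leq leH.
Qed.

(** Otherwise [A] and [M] share a nonzero element; its degree is at most
    [\dim M], hence at most [\dim {:L} - \dim M] because [M] has index at
    least 2, and this is less than [\dim A]. *)
Lemma dim_chowla_le (K : fieldType) (L : fieldExtType K)
    (A : {vspace L}) (M : {subfield L}) :
  chowla A -> (\dim M < \dim {:L})%N -> (\dim A + \dim M <= \dim {:L})%N.
Proof.
case=> _ degA ltML; rewrite leqNgt; apply/negP => ltLAM.
have capn0 : (A :&: M)%VS != 0%VS.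
  apply: contraTneq ltLAM => E; rewrite -leqNgt -dimv_sum_cap E dimv0 addn0.
  by rewrite dimvS ?subvf.
have := memv_pick (A :&: M)%VS; rewrite memv_cap => /andP[aA aM].
have ltA := degA _ aA; rewrite vpick0 in ltA; have {}ltA := ltA capn0.
have leM : (\dim <<1; vpick (A :&: M)>> <= \dim M)%N.
  by rewrite dimvS //; apply/FadjoinP; rewrite sub1v.
have /dvdnP[t dL] := field_dimS (subvf M).
rewrite dL in ltLAM ltML.
have t1 : (1 < t)%N by case: t ltML {dL ltLAM} => [|[|t]]; lia.
by nia.
Qed.

(** The Galois group is cyclic, generated by some [alpha]; over the fixed
    field of [alpha ^+ d], the degree of [L] is the order [\dim {:L} / d] of
    [alpha ^+ d]. *)
Lemma finField_subfield_dim (F : finFieldType) (L : fieldExtType F) (d : nat) :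
  (d %| \dim {:L})%N -> exists M : {subfield L}, \dim M = d.
Proof.
wlog [{}L ->] : L / exists galL : splittingFieldType F, L = galL.
  by pose galL := FinSplittingFieldType F L => /(_ galL); apply; exists galL.
move=> dv; have galL := finField_galois (sub1v {:L}%AS).
have [alpha /eqP genL _] := finField_galois_generator (sub1v {:L}%AS).
exists [aspace of fixedField <[alpha ^+ d]>]%g.
have n0 : (0 < \dim {:L})%N by rewrite adim_gt0.
have := galois_dim galL; rewrite dimv1 divn1 genL => dimL.
have := dim_fixedField <[alpha ^+ d]>.
rewrite -[#|<[alpha]>%g|]/(#[alpha]%g) in dimL.
rewrite -[#|_|]/(#[_]%g) orderXdiv -dimL // => dimLM.
apply/eqP; rewrite -(eqn_pmul2l (_ : 0 < \dim {:L} %/ d)%N).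
  by rewrite {1}dimLM -dim_sup_field ?subvf // divnK.
have d0 := dvdn_gt0 n0 dv.
by rewrite divn_gt0 //; exact: dvdn_leq n0 dv.
Qed.

Section Counting.

Variables (F : finFieldType) (L : fieldExtType F).

Lemma card_vspace_nz (V : {vspace L}) :
  #|[set x : finvect_type L | (x \in V) && (x != 0)]| = (#|F| ^ \dim V).-1.
Proof.
have /= <- := card_vspace (V : {vspace finvect_type L}).
rewrite [in RHS](cardD1 0) mem0v /=.
by apply: eq_card => x; rewrite !inE andbC.
Qed.

(** Each [x] in [S] rules out the [c] of the form [y / x] with [y] a nonzero
    element of [H]; there are too few such quotients to exhaust the nonzero
    elements of [L]. *)
Lemma exists_multiple_avoiding (H : {vspace L}) (S : {set finvect_type L}) :
    0 \notin S -> (#|S| * (#|F| ^ \dim H).-1 < (#|F| ^ \dim {:L}).-1)%N ->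
  exists2 c : L, c != 0 & {in S, forall x : L, c * x \notin H}.
Proof.
move=> S0; rewrite -!card_vspace_nz => ltSL.
set H' := [set y | _] in ltSL; set L' := [set y | _] in ltSL.
pose B := [set (z.2 / z.1)%R | z in setX S H'].
have ltB : (#|B| < #|L'|)%N.
  by apply: leq_ltn_trans (leq_imset_card _ _) _; rewrite cardsX.
have /subsetPn[c cL cB] : ~~ (L' \subset B).
  by apply: contraL ltB => /subset_leq_card; rewrite -leqNgt.
have cn0 : c != 0 by move: cL; rewrite inE => /andP[].
exists c => // x xS; apply: contra cB => cxH; apply/imsetP.
have xn0 : x != 0 by apply: contraNneq S0 => <-.
exists (x, c * x); last by rewrite /= mulfK.
by rewrite !inE xS cxH /= mulf_neq0.
Qed.

Lemma mem_subfield_dim (x : L) (M : {subfield L}) :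
  \dim <<1; x>> = \dim M -> x \in M.
Proof.
(* membership in a subfield is a condition on its order only *)
move=> dimM; rewrite Fermat's_little_theorem -dimM.
by rewrite -Fermat's_little_theorem memv_adjoin.
Qed.

Definition low_degree (d : nat) : {set finvect_type L} :=
  [set x : finvect_type L | (x != 0) && (\dim <<1; (x : L)>> < d)%N].

(** All the elements of degree [d] lie in one subfield of order [#|F| ^ d], so
    passing from [d] to [d + 1] adds fewer than [#|F| ^ d] elements and at
    most doubles the bound. *)
Lemma card_low_degree (d : nat) : (#|low_degree d| < #|F| ^ d)%N.
Proof.
have q_gt1 := finNzRing_gt1 F.
elim: d => [|d IHd].
  rewrite expn0 ltnS leqn0 cards_eq0; apply/eqP/setP=> x.
  by rewrite !inE andbF.
pose E := [set x : finvect_type L | (x != 0) && (\dim <<1; (x : L)>> == d)%N].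
have leE : (#|E| <= (#|F| ^ d).-1)%N.
  have [->|[x0]] := set_0Vmem E; first by rewrite cards0.
  rewrite inE => /andP[_ /eqP dimx0].
  rewrite -[in leqRHS]dimx0 -card_vspace_nz; apply: subset_leq_card.
  apply/subsetP=> x; rewrite !inE => /andP[-> /eqP dimx].
  by rewrite andbT (mem_subfield_dim (M := <<1; x0>>%AS)) //= dimx dimx0.
have -> : low_degree d.+1 = low_degree d :|: E.
  by apply/setP=> x; rewrite !inE -andb_orr ltnS leq_eqVlt orbC.
have /(leq_trans _) := leq_mul q_gt1 (leqnn (#|F| ^ d)%N).
rewrite -expnS; apply.
apply: leq_ltn_trans (leq_card_setU (low_degree d) E).1 _.
rewrite mul2n -addnn -addnS; apply: leq_add (ltnW IHd) _.
by apply: leq_ltn_trans leE _; rewrite ltn_predL expn_gt0 ltnW.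
Qed.

End Counting.

(** The subspace is a multiple of a hyperplane over the largest proper
    subfield [M]; it avoids [M] and all the elements of degree less than
    [\dim M], so its nonzero elements have degree [\dim {:L}]. *)
Lemma exists_chowla (F : finFieldType) (L : fieldExtType F)
    (n := \dim {:L}) :
  (1 < n)%N ->
  exists2 A : {vspace L}, chowla A & \dim A = (n - n %/ pdiv n)%N.
Proof.
move=> n_gt1; set p := pdiv n.
have p_pr : prime p by exact: pdiv_prime.
have pn : (p %| n)%N := pdiv_dvd n.
have [M dimM] := finField_subfield_dim (dvdn_div pn).
set m := (n %/ p)%N in dimM *.
have m_gt0 : (0 < m)%N by rewrite -dimM adim_gt0.
have m_lt_n : (m < n)%N by rewrite ltn_Pdiv ?prime_gt1 // ltnW.
have [H MH dimH] := subfield_hyperplane M.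
rewrite dimM in dimH.
(* [1] stands for all the nonzero elements of [M] *)
pose S := 1 |: low_degree L m.
have [||c cn0 cS] := @exists_multiple_avoiding F L H S.
- by rewrite !inE eqxx eq_sym oner_eq0.
- have leS : (#|S| <= #|F| ^ m)%N.
    apply: leq_trans (card_low_degree L m).
    by rewrite cardsU1; case: (_ \notin _).
  apply: leq_ltn_trans (leq_mul leS (leqnn _)) _.
  rewrite dimH -!subn1 mulnBr muln1 -expnD subnKC; last exact: ltnW.
  apply: ltn_sub2l.
    by rewrite -(expn0 #|F|) ltn_exp2l ?finNzRing_gt1 // ltnW.
  by rewrite -(expn0 #|F|) ltn_exp2l ?finNzRing_gt1.
have c1 := cS 1 (setU11 _ _); rewrite mulr1 in c1.
have dimA : \dim (H * <[c^-1]>) = (n - m)%N by rewrite dim_cosetv ?invr_eq0.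
exists (H * <[c^-1]>)%VS => //; split.
  by apply/eqP; rewrite -dimv_eq0 dimA -lt0n subn_gt0.
move=> a /memv_cosetP[h hH aE] an0.
have {aE}caE : c * a = h by rewrite aE mulrCA mulfV ?mulr1.
rewrite -{}caE in hH.
have deg_ge_m : (m <= \dim <<1; a>>)%N.
  rewrite leqNgt; apply: contraL hH => ltam.
  by apply: cS; rewrite !inE an0 ltam orbT.
have deg_neq_m : \dim <<1; a>> != m.
  apply: contra c1 => /eqP dima.
  have aM : a \in M by apply: mem_subfield_dim; rewrite dimM.
  have -> : c = a^-1 * (c * a) by rewrite mulrCA mulVf ?mulr1.
  by move/subvP: MH; apply; apply: memv_mul; rewrite ?rpredV.
have deg_gt_m : (m < \dim <<1; a>>)%N by rewrite ltn_neqAle eq_sym deg_neq_m.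
suff -> : \dim <<1; a>> = n.
  by rewrite dimA ltn_subrL m_gt0 ltnW.
have deg_dvd : (\dim <<1; a>> %| n)%N := field_dimS (subvf <<1; a>>%AS).
have [e nE] := dvdnP deg_dvd.
have e_lt_p : (e < p)%N.
  rewrite -(ltn_pmul2r (ltn_trans m_gt0 deg_gt_m)) -nE -(divnK pn) mulnC.
  by rewrite ltn_pmul2l ?prime_gt0.
have e_le1 : (e <= 1)%N.
  rewrite leqNgt; apply: contraL e_lt_p => e_gt1.
  by rewrite -leqNgt pdiv_min_dvd // nE dvdn_mulr.
move: e_le1 (ltnW n_gt1); rewrite nE.
by case: (e) => [|[|]] // _ _; rewrite mul1n.
Qed.

Local Close Scope ring_scope.

Theorem theorem5p1 (n : nat) (hn : 1 < n)
    (q r k : nat) (hr : prime r) (hk : 0 < k) (hq : q = r ^ k)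
    (F : finFieldType) (hF : #|F| = q)
    (L : fieldExtType F) (hL : \dim {:L} = n) :
  chowla_num L = n - n %/ pdiv n.
Proof.
subst n; apply/eqP; rewrite eqn_leq; apply/andP; split.
  have [A chA <-] := chowla_numP hn.
  have [M dimM] := finField_subfield_dim (dvdn_div (pdiv_dvd (\dim {:L}))).
  have := dim_chowla_le (M := M) chA; rewrite dimM => leA.
  rewrite leq_subRL ?leq_div // addnC leA //.
  by rewrite ltn_Pdiv ?prime_gt1 ?pdiv_prime // ltnW.
have [A chA <-] := exists_chowla hn.
exact: chowla_num_ge.
Qed.
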